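(* Let $K$ be a field, $S=K[x_1,\ldots,x_n]$, and let $I$ be an almost complete intersection monomial ideal of $S$. Then $S/I$ is pretty clean.
   Context: For a monomial ideal $I$ of $S$, $G(I)$ denotes the unique minimal set of monomial generators of $I$, $\mu(I)$ denotes the number of elements of $G(I)$, and $\operatorname{ht} I$ is the height of $I$. A monomial ideal $I$ is said to be almost complete intersection if $\mu(I)=\operatorname{ht} I+1$. A monomial prime ideal is a prime ideal generated by a (possibly empty) subset of the variables. The ring $S/I$ is called pretty clean if there exists a finite chain $I=I_0\subset I_1\subset\cdots\subset I_r=S$ of monomial ideals such that $I_i/I_{i-1}\cong S/\mathfrak p_i$ for monomial prime ideals $\mathfrak p_i$ of $S$ ($1\le i\le r$), and such that for all $i<j$ for which $\mathfrak p_i\subseteq\mathfrak p_j$, it follows that $\mathfrak p_i=\mathfrak p_j$. *)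

(* Defs.v *)
From HB Require Import structures.
From mathcomp Require Import all_boot all_algebra.
From mathcomp Require Import finmap.
From mathcomp Require Import mpoly.

Set Implicit Arguments.
Unset Strict Implicit.
Unset Printing Implicit Defensive.

Import GRing.Theory Quotient.

Local Open Scope ring_scope.
Local Open Scope quotient_scope.

(* As usual in MathComp, ideals are boolean predicates; unlike idealr, this   *)
(* type contains the unit ideal.                                              *)
Notation ideal R := (submodClosed R^o).

Section SubmoduleType.
Context (R : pzRingType) (V : lmodType R) (M : submodClosed V).

Record submod_of := SubmodOf { submod_val : V; _ : submod_val \in M }.

HB.instance Definition _ := [isSub for submod_val].
HB.instance Definition _ := [Choice of submod_of by <:].
HB.instance Definition _ := [SubChoice_isSubLmodule of submod_of by <:].

End SubmoduleType.

Section QuotientModule.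
Context (R : pzRingType) (V : lmodType R) (N : submodClosed V).

(* submodClosed does not inherit from zmodClosed, which {quot _} requires. *)
Definition submod_zmod : {pred V} := N.

HB.instance Definition _ := GRing.isZmodClosed.Build V submod_zmod
  (GRing.submod_closedB (submodClosedP N)).

Definition quotmod := {quot submod_zmod}.

HB.instance Definition _ := GRing.Zmodule.on quotmod.
HB.instance Definition _ := EqQuotient.on quotmod.

Definition quotmod_scale (a : R) (u : quotmod) : quotmod :=
  \pi_quotmod (a *: repr u).

Lemma pi_quotmod_eq (x y : V) :
  (\pi_quotmod x == \pi_quotmod y) = (x - y \in N).
Proof. by rewrite -(idealrBE submod_zmod). Qed.

Lemma pi_quotmodD (x y : V) :
  \pi_quotmod (x + y) = \pi_quotmod x + \pi_quotmod y.
Proof. exact: (raddfD (\pi_{quot submod_zmod})). Qed.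

Lemma pi_quotmodZ (a : R) (x : V) :
  \pi_quotmod (a *: x) = quotmod_scale a (\pi_quotmod x).
Proof.
apply/eqP; rewrite /quotmod_scale pi_quotmod_eq -scalerBr rpredZ//.
by rewrite -pi_quotmod_eq reprK.
Qed.

Lemma quotmod_scalerA a b u :
  quotmod_scale a (quotmod_scale b u) = quotmod_scale (a * b) u.
Proof.
by rewrite -[u]reprK -(pi_quotmodZ b) -(pi_quotmodZ a) -pi_quotmodZ scalerA.
Qed.

Lemma quotmod_scale1r : left_id 1 quotmod_scale.
Proof. by move=> u; rewrite -[u]reprK -pi_quotmodZ scale1r. Qed.

Lemma quotmod_scalerDr : right_distributive quotmod_scale +%R.
Proof.
move=> a u v; rewrite -[u]reprK -[v]reprK -pi_quotmodD.
by rewrite -(pi_quotmodZ a (repr u)) -(pi_quotmodZ a (repr v)) -pi_quotmodZ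
  -pi_quotmodD scalerDr.
Qed.

Lemma quotmod_scalerDl u : {morph quotmod_scale^~ u : a b / a + b}.
Proof.
move=> a b; rewrite -[u]reprK -(pi_quotmodZ a) -(pi_quotmodZ b).
by rewrite -pi_quotmodZ -pi_quotmodD scalerDl.
Qed.

HB.instance Definition _ := GRing.Zmodule_isLmodule.Build R quotmod
  quotmod_scalerA quotmod_scale1r quotmod_scalerDr quotmod_scalerDl.

End QuotientModule.

Section Subquotient.
Context (R : pzRingType) (V : lmodType R) (M N : submodClosed V).

Definition submod_within : {pred submod_of M} := [pred x | val x \in N].

Fact submod_within_subproof : subsemimod_closed submod_within.
Proof.
split=> [|a x]; last by rewrite !inE linearZ; apply: rpredZ.
by split=> [|x y]; rewrite !inE ?raddf0 ?rpred0// raddfD; apply: rpredD.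
Qed.

HB.instance Definition _ := GRing.isSubSemiModClosed.Build R (submod_of M)
  submod_within submod_within_subproof.

(* M / N when N is contained in M; M / (M :&: N) in general. *)
Definition subquot := quotmod submod_within.

HB.instance Definition _ := GRing.Lmodule.on subquot.

End Subquotient.

Definition lmod_iso (R : pzRingType) (U W : lmodType R) : Prop :=
  exists f : {linear U -> W}, bijective f.

Section Ideals.
Context (R : comNzRingType).

Definition prime_ideal (P : {pred R}) : Prop :=
  idealr_closed P /\ prime_idealr_closed P.

Definition strict_sub (P Q : {pred R}) : Prop :=
  {subset P <= Q} /\ exists2 x, x \in Q & x \notin P.

Definition prime_chain (h : nat) (C : nat -> {pred R}) (P : {pred R}) : Prop :=
  [/\ forall i, (i <= h)%N -> prime_ideal (C i),
      forall i, (i < h)%N -> strict_sub (C i) (C i.+1)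
    & C h =i P].

Definition prime_height_ge (P : {pred R}) (h : nat) : Prop :=
  exists C, prime_chain h C P.

Definition prime_height (P : {pred R}) (h : nat) : Prop :=
  prime_height_ge P h /\ forall k, prime_height_ge P k -> (k <= h)%N.

(* height I h states that the minimum of the heights of the prime ideals      *)
(* containing I is h; it fails for all h when I is the unit ideal.            *)
Definition height (I : {pred R}) (h : nat) : Prop :=
  (exists P, [/\ prime_ideal P, {subset I <= P} & prime_height P h]) /\
  (forall P, prime_ideal P -> {subset I <= P} -> prime_height_ge P h).

(* I is the ideal generated by the F t, for t in A. *)
Definition generated_by (T : Type) (F : T -> R) (A : {pred T}) (I : {pred R}) :
    Prop :=
  forall x, x \in I <->
    exists2 s : seq (R * T), all (fun c => c.2 \in A) s
                           & x = \sum_(c <- s) c.1 * F c.2.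

End Ideals.

Section MonomialIdeals.
Context (K : fieldType) (n : nat).
Local Notation S := {mpoly K[n]}.

Definition monomial_generators (A : {pred 'X_{1..n}}) (I : {pred S}) : Prop :=
  generated_by (fun m => 'X_[m] : S) A I.

Definition monomial_ideal (I : {pred S}) : Prop :=
  exists A : {pred 'X_{1..n}}, monomial_generators A I.

(* G = G(I); such a G is unique, and finite by Dickson's lemma. *)
Definition minimal_generators (G : {fset 'X_{1..n}}) (I : {pred S}) : Prop :=
  monomial_generators (mem G) I /\
  forall G' : {fset 'X_{1..n}},
    (G' `<=` G)%fset -> monomial_generators (mem G') I -> G' = G.

Definition almost_complete_intersection (I : {pred S}) : Prop :=
  exists (G : {fset 'X_{1..n}}) (h : nat),
    [/\ minimal_generators G I, height I h & #|` G| = h.+1].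

Definition monomial_prime (P : {pred S}) : Prop :=
  prime_ideal P /\
  exists A : {set 'I_n}, generated_by (fun i => 'X_i : S) (mem A) P.

(* The primes are indexed from 0: p i belongs to the factor c i.+1 / c i.    *)
Definition pretty_clean (I : ideal S) : Prop :=
  exists (r : nat) (c p : nat -> ideal S),
    [/\ c 0%N =i I /\ c r =i predT,
        forall i, (i <= r)%N -> monomial_ideal (c i),
        forall i, (i < r)%N -> strict_sub (c i) (c i.+1),
        forall i, (i < r)%N ->
          monomial_prime (p i) /\
          lmod_iso (subquot (c i.+1) (c i)) (quotmod (p i))
      & forall i j, (i < j < r)%N -> {subset p i <= p j} -> p i =i p j].

End MonomialIdeals.

(* Main.v *)
(* If I has h + 1 generators and height h, choose a variable y dividing two   *)
(* of them.  Then I : y again has at most h + 1 generators and height >= h,   *)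
(* with smaller total degree, while (I, y) has at most h generators and       *)
(* height >= h, so that repeatedly splitting off variables filters S / (I, y) *)
(* by quotients S / P with P of height exactly h.  As (I, y) / I is           *)
(* isomorphic to S / (I : y), concatenating the filtrations of S / (I : y)    *)
(* and S / (I, y) yields heights that do not increase.  If no such y exists,  *)
(* the generators are pairwise coprime, and the same splitting yields primes  *)
(* whose height is the number of generators.  The height of I enters only     *)
(* through the bound ht (x_i | i in A) <= #|A|, which follows from dim S <=   *)
(* n: by a dimension count any n + 1 elements of S are algebraically          *)
(* dependent, whereas elements x_i of C (i + 1) outside C i, for a chain C of *)
(* primes, are not.                                                           *)

Require Import Defs.
From HB Require Import structures.
From mathcomp Require Import all_boot all_algebra.
From mathcomp Require Import finmap.
From mathcomp Require Import mpoly.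
From mathcomp Require Import ring zify.

Set Implicit Arguments.
Unset Strict Implicit.
Unset Printing Implicit Defensive.

Import GRing.Theory Quotient.

Local Open Scope ring_scope.
Local Open Scope quotient_scope.

(** The argument is carried out on lists [L] of exponents. The prime (x_i | i in A) contains the
    ideal (L) exactly when [A] is a [transversal] of [L], so [prime_height_variables] turns a lower
    bound on the height into [transversal_ge h L]. This bound survives both the colon by y and the
    addition of y, since each enlarges the ideal. By induction on the total degree,
    [sorted_prime_filtration] builds a filtration whose primes never gain generators, and
    [pure_prime_filtration] handles the ideals (L, y) and the coprime case. In
    [pretty_clean_of_filtration] this ordering suffices: if an earlier set of variables lies in a
    later, no larger one, the two are equal. *)

(** * Filtrations of monomial ideals, in terms of exponents *)

Section MonomialCombinatorics.
Context (n : nat).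
Implicit Types (L : seq 'X_{1..n}) (A : {set 'I_n}) (m u w : 'X_{1..n}).
Implicit Types (y : 'I_n) (h : nat) (s : seq ('X_{1..n} * {set 'I_n})).

Definition upset L : pred 'X_{1..n} := fun m => has (fun u => (u <= m)%MM) L.

Definition variables A : seq 'X_{1..n} := [seq U_(i)%MM | i <- enum A].

(** Containment of (L) in the prime (x_i | i in A), tested on generators. *)
Definition transversal L A := all (upset (variables A)) L.

(** Subtraction of exponents is truncated: members not divisible by y are kept, and the list
    generates (L) : y, possibly redundantly. *)
Definition colon L y := [seq (u - U_(y))%MM | u <- L].

Lemma upset_closed L m w : upset L m -> (m <= w)%MM -> upset L w.
Proof.
move=> /hasP[u uL um] mw; apply/hasP; exists u => //.
exact: lepm_trans um mw.
Qed.

Lemma upset_variablesP A m :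
  reflect (exists2 i, i \in A & (U_(i)%MM <= m)%MM) (upset (variables A) m).
Proof.
apply: (iffP hasP) => [[_ /mapP[i iA ->] im]|[i iA im]].
  by exists i => //; rewrite mem_enum in iA.
by exists U_(i)%MM => //; rewrite map_f ?mem_enum.
Qed.

Lemma upset_variables0 A : upset (variables A) 0%MM = false.
Proof. by apply/upset_variablesP => -[i _]; rewrite lep1mP mnm0E. Qed.

Lemma upset_variables1 A i : upset (variables A) U_(i)%MM = (i \in A).
Proof.
apply/upset_variablesP/idP => [[j jA]|iA]; last by exists i => //; exact: lepm_refl.
by rewrite lep1mP mnm1E eqb0 negbK => /eqP->.
Qed.

Lemma lepm_subr u m y : ((u - U_(y))%MM <= m)%MM = (u <= m + U_(y)%MM)%MM.
Proof.
by apply/mnm_lepP/mnm_lepP => le_um i; move: (le_um i);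
  rewrite mnmBE mnmDE leq_subLR addnC.
Qed.

Lemma upset_colon L y m : upset (colon L y) m = upset L (m + U_(y))%MM.
Proof. by rewrite /upset has_map; apply: eq_has => u /=; rewrite lepm_subr. Qed.

Lemma transversal_colon L y A : transversal (colon L y) A -> transversal L A.
Proof.
move=> /allP tA; apply/allP => u uL; apply: upset_closed (tA _ (map_f _ uL)) _.
exact: lem_subr.
Qed.

(* The pairs (w, A) of s list the successive steps J, J + (w) of a filtration *)
(* from the ideal (L) to the unit ideal with J : w = (x_i | i in A).          *)
Fixpoint prime_filtration L s : Prop :=
  if s is (w, A) :: s' then
    (forall m, upset L (w + m)%MM = upset (variables A) m) /\
    prime_filtration (w :: L) s'
  else upset L 0%MM.

Lemma prime_filtration_ext L L' s :
  upset L =1 upset L' -> prime_filtration L s -> prime_filtration L' s.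
Proof.
elim: s L L' => [|[w A] s IHs] L L' eqL /=; first by rewrite eqL.
case=> colonA /IHs fs; split=> [m|]; first by rewrite -eqL.
by apply: fs => m /=; rewrite -!/(upset _ _) eqL.
Qed.

(** Multiplication by y identifies S / (L : y) with (L, y) / (L), so a step w of the first
    filtration becomes the step wy; the second then starts from (L, y). *)
Lemma prime_filtration_cat L y s1 s2 :
    prime_filtration (colon L y) s1 -> prime_filtration (U_(y)%MM :: L) s2 ->
  prime_filtration L ([seq (c.1 + U_(y), c.2)%MM | c <- s1] ++ s2).
Proof.
(* When [s1] is exhausted, y already lies in (L), so adjoining it changes nothing. *)
elim: s1 L => [|[w A] s1 IHs1] L /=.
  rewrite upset_colon add0m => Ly; apply: prime_filtration_ext => m /=.
  by rewrite -/(upset _ _); case: (boolP (_ <= m)%MM) => //= /(upset_closed Ly) ->.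
case=> colonA f1 f2; split=> [m|].
  by rewrite -colonA upset_colon -!addmA [(m + _)%MM]addmC.
apply: IHs1.
  apply: prime_filtration_ext f1 => m.
  by rewrite upset_colon /= -!/(upset _ _) upset_colon -lepm_subr addmK.
(* The extra generator wy is redundant once y is present. *)
apply: prime_filtration_ext f2 => m /=; rewrite -!/(upset _ _).
case: (boolP (U_(y)%MM <= m)%MM) => //= yNm; case: (boolP (_ <= m)%MM) => // wym.
by case/negP: yNm; apply: lepm_trans wym; exact: lem_addl.
Qed.

Definition indivisible y := [pred u : 'X_{1..n} | u y == 0].

Definition plus_variable L y := U_(y)%MM :: filter (indivisible y) L.

Lemma upset_plus_variable L y : upset (plus_variable L y) =1 upset (U_(y)%MM :: L).
Proof.
move=> m /=; case: (boolP (U_(y)%MM <= m)%MM) => //= yNm.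
apply/hasP/hasP => -[u]; first by rewrite mem_filter => /andP[_ uL]; exists u.
move=> uL um; exists u => //; rewrite mem_filter uL andbT /=.
by apply: contraNT yNm => uy; apply: lepm_trans um; rewrite lep1mP.
Qed.

Lemma transversal_plus_variable L y A :
  transversal (plus_variable L y) A -> transversal L A.
Proof.
case/andP; rewrite upset_variables1 => yA /allP tA; apply/allP => u uL.
have [uy|uy] := eqVneq (u y) 0; first by apply: tA; rewrite mem_filter /= uy eqxx.
by apply/upset_variablesP; exists y => //; rewrite lep1mP.
Qed.

(** The bookkeeping behind both inductions: y costs one generator and saves each one it divides, so
    the size does not grow if y divides one member and drops if it divides two. *)
Lemma size_plus_variable L y :
  (size (plus_variable L y) + count (predC (indivisible y)) L)%N = (size L).+1.
Proof. by rewrite /= size_filter addSn count_predC. Qed.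

Definition total_degree L := sumn [seq mdeg u | u <- L].

Lemma total_degree_filter p L : (total_degree (filter p L) <= total_degree L)%N.
Proof.
rewrite /total_degree; elim: L => //= u L IHL; case: (p u) => /=.
  by rewrite leq_add2l.
exact: leq_trans IHL (leq_addl _ _).
Qed.

Lemma total_degree_colon L y u :
  u \in L -> u y != 0 -> (total_degree (colon L y) < total_degree L)%N.
Proof.
rewrite /total_degree; elim: L => //= v L IHL; rewrite inE.
have le_v : (mdeg (v - U_(y)) <= mdeg v)%N by exact: mdegB.
case/predU1P => [->|uL] uy; last by rewrite -addnS leq_add // IHL.
rewrite -addSn leq_add //.
  have yv : (U_(y) <= v)%MM by rewrite lep1mP.
  by rewrite -{2}(submK yv) mdegD mdeg1 addn1.
by elim: (L) => //= v' L' IHL'; rewrite leq_add // mdegB.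
Qed.

(** The bound on [mdeg u] gives strictness: trading the variable y for itself would leave the degree
    unchanged. *)
Lemma total_degree_plus_variable L y u : u \in L -> u y != 0 -> (1 < mdeg u)%N ->
  (total_degree (plus_variable L y) < total_degree L)%N.
Proof.
rewrite /total_degree /= mdeg1; elim: L => //= v L IHL; rewrite inE.
case/predU1P => [<-|uL] uy degu; last first.
  have := IHL uL uy degu; case: ifP => _ /=; first by rewrite addnCA ltn_add2l.
  by move=> lt_uL; apply: leq_trans lt_uL (leq_addl _ _).
by rewrite (negbTE uy) -addSn leq_add // total_degree_filter.
Qed.

Definition transversal_ge h L := forall A, transversal L A -> (h <= #|A|)%N.

Lemma exists_variable u : (1 < mdeg u)%N -> exists y, u y != 0.
Proof.
move=> u1; apply/existsP; apply: contraTT u1 => /existsPn u0.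
have -> : u = 0%MM; last by rewrite mdeg0.
by apply/mnmP => y; rewrite mnm0E; apply/eqP; rewrite -[_ == _]negbK u0.
Qed.

Lemma pure_prime_filtration h L : (size L <= h)%N -> transversal_ge h L ->
  exists2 s, prime_filtration L s & all (fun c : _ * {set _} => #|c.2| == h) s.
Proof.
have [d] := ubnP (total_degree L); elim: d L => // d IHd L ltLd sizeL tauL.
have [L0|L0] := boolP (0%MM \in L).
  by exists [::] => //=; apply/hasP; exists 0%MM => //; exact: lepm_refl.
have [/hasP[u uL u1]|/hasPn L1] := boolP (has (fun u => 1 < mdeg u)%N L).
  have [y uy] := exists_variable u1.
  have [] := IHd (colon L y); rewrite ?size_map//.
  - exact: leq_trans (total_degree_colon uL uy) _.
  - by move=> A /transversal_colon; apply: tauL.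
  move=> s1 f1 h1; have [] := IHd (plus_variable L y).
  - exact: leq_trans (total_degree_plus_variable uL uy u1) _.
  - rewrite (leq_trans _ sizeL)// -ltnS -(size_plus_variable L y) -addn1 leq_add2l.
    by rewrite -has_count; apply/hasP; exists u.
  - by move=> A /transversal_plus_variable; apply: tauL.
  move=> s2 /(prime_filtration_ext (upset_plus_variable _ _)) f2 h2.
  exists ([seq (c.1 + U_(y), c.2)%MM | c <- s1] ++ s2).
    exact: prime_filtration_cat.
  by rewrite all_cat h2 andbT all_map.
(* No member is 1 and none has degree above 1, so [L] lists variables, perhaps with repetitions, and
   one step with w = 1 suffices. *)
pose A := [set i | U_(i)%MM \in L].
have LA : L =i variables A.
  move=> u; apply/idP/mapP => [uL|[i]]; last by rewrite mem_enum inE => ? ->.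
  have := L1 _ uL; rewrite -leqNgt => u1.
  have /mdeg1P[i /eqP ui] : mdeg u == 1%N.
    by rewrite eqn_leq u1 lt0n mdeg_eq0; apply: contraNneq L0 => <-.
  by exists i; rewrite ?mem_enum ?inE -?ui.
exists [:: (0%MM, A)] => /=.
  split=> [m|]; last by rewrite -/(upset _ _) (_ : (_ <= _)%MM) //; exact: lepm_refl.
  by rewrite add0m; apply: eq_has_r.
(* [A] is itself a transversal, whence h <= #|A| <= size L <= h. *)
rewrite andbT eqn_leq; apply/andP; split; last first.
  apply: tauL; apply/allP => u; rewrite LA => uA.
  by apply/hasP; exists u => //; exact: lepm_refl.
apply: leq_trans sizeL; rewrite cardE -(size_map (fun i => U_(i)%MM)).
apply: uniq_leq_size => [|u]; last by rewrite LA.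
by rewrite map_inj_uniq ?enum_uniq // => i j /mnmP/(_ i); rewrite !mnm1E eqxx; case: eqP.
Qed.

Lemma size_le_transversal L A : transversal L A ->
    (forall y, count (predC (indivisible y)) L <= 1)%N ->
  (size L <= #|A|)%N.
Proof.
move=> /allP tA L1; rewrite -sum1_size -sum1_card.
(* Double counting of the pairs (u, y) with y in [A] dividing u: at least one for each u, at most
   one for each y. *)
apply: (@leq_trans (\sum_(u <- L) \sum_(y in A) (u y != 0))%N).
  rewrite [leqLHS]big_seq [leqRHS]big_seq; apply: leq_sum => u /tA/upset_variablesP[y yA].
  by rewrite lep1mP => uy; rewrite (bigD1 y) //= uy.
rewrite exchange_big; apply: leq_sum => y _; apply: leq_trans (L1 y).
by rewrite -sum1_count [leqRHS]big_mkcond; apply: leq_sum => u _ /=; case: eqP.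
Qed.

Lemma sorted_prime_filtration h L : (size L <= h.+1)%N -> transversal_ge h L ->
  exists2 s, prime_filtration L s &
    all (fun c : _ * {set _} => h <= #|c.2|)%N s &&
    sorted geq [seq #|c.2| | c : _ * {set _} <- s].
Proof.
have pure k s : all (fun c : 'X_{1..n} * {set 'I_n} => #|c.2| == k) s ->
    (h <= k)%N -> all (fun c : _ * {set _} => h <= #|c.2|)%N s &&
    sorted geq [seq #|c.2| | c : _ * {set _} <- s].
  move=> sk hk; apply/andP; split; first by apply: sub_all sk => c /eqP->.
  elim: s sk => //= c [|c' s] IHs //= /and3P[/eqP-> /eqP ck sk].
  by have := IHs; rewrite /= ck => -> //; rewrite ?eqxx ?leqnn.
have [d] := ubnP (total_degree L); elim: d L => // d IHd L ltLd sizeL tauL.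
have [/existsP[y y2]|/existsPn L1] :=
    boolP [exists y, 1 < count (predC (indivisible y)) L]%N; last first.
  (* For pairwise coprime generators the bound rises to [size L], which settles the case of h + 1
     generators. *)
  have tauL' : transversal_ge (size L) L.
    by move=> A tA; apply: size_le_transversal tA _ => y; rewrite leqNgt.
  have [leLh|ltLh] := leqP (size L) h.
    have [s fs hs] := pure_prime_filtration leLh tauL.
    by exists s => //; apply: pure hs _.
  have [s fs hs] := pure_prime_filtration (leqnn _) tauL'.
  by exists s => //; apply: pure hs _; exact: ltnW.
have /hasP[u uL uy] : has (predC (indivisible y)) L by rewrite has_count (ltn_trans _ y2).
have [] := IHd (colon L y); rewrite ?size_map//.
- exact: leq_trans (total_degree_colon uL uy) _.
- by move=> A /transversal_colon; apply: tauL.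
(* At least two generators go and one comes, so at most h remain and this part is pure of height
   h. *)
move=> s1 f1 /andP[h1 sort1]; have [] := @pure_prime_filtration h (plus_variable L y).
- rewrite -(leq_add2r 2); apply: (@leq_trans (size L).+1); last by rewrite addn2.
  by rewrite -(size_plus_variable L y) leq_add2l.
- by move=> A /transversal_plus_variable; apply: tauL.
move=> s2 /(prime_filtration_ext (upset_plus_variable _ _)) f2 h2.
exists ([seq (c.1 + U_(y), c.2)%MM | c <- s1] ++ s2).
  exact: prime_filtration_cat.
have /andP[h2' sort2] := pure _ _ h2 (leqnn _).
rewrite all_cat h2' andbT all_map h1 /= map_cat -map_comp /comp /=.
have tr : transitive geq by move=> a b c /= ba cb; exact: leq_trans cb ba.
(* Across the junction, sizes at least h are followed by sizes equal to h. *)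
rewrite sorted_pairwise // pairwise_cat -!sorted_pairwise // sort1 sort2 !andbT.
apply/allrelP => _ _ /mapP[c /(allP h1) hc ->] /mapP[c' /(allP h2)/eqP hc' ->].
by rewrite /= hc'.
Qed.

End MonomialCombinatorics.

(** * Ideals and cyclic subquotients *)

Section IdealClosure.
Context (R : comNzRingType) (N : ideal R).

Lemma ideal_add (x y : R) : x \in N -> y \in N -> x + y \in N.
Proof. exact: (@rpredD R^o N). Qed.

Lemma ideal_mul (a x : R) : x \in N -> a * x \in N.
Proof. exact: (@rpredZ R R^o N a x). Qed.

Lemma ideal_sub (x y : R) : x \in N -> y \in N -> x - y \in N.
Proof. by move=> xN yN; rewrite -mulN1r ideal_add // ideal_mul. Qed.

End IdealClosure.

Section CyclicSubquotient.
Context (R : comNzRingType) (M N P : ideal R) (w : R).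

(** M / N is generated by the class of [w], with annihilator N : w = P. The map sends x to the class
    of any a with x - a w in N; the inverse multiplies [w] by a representative. *)
Lemma cyclic_subquot_iso :
    w \in M -> (forall a, (a * w \in N) = (a \in P)) ->
    (forall x, x \in M -> exists a, x - a * w \in N) ->
  lmod_iso (subquot M N) (quotmod P).
Proof.
move=> wM colonP genM.
have valL c (x y : submod_of M) : val (c *: x + y) = c * val x + val y.
  exact: (linearP (val : submod_of M -> R^o)).
have valB (x y : submod_of M) : val (x - y) = val x - val y.
  exact: (raddfB (val : submod_of M -> R^o)).
have valZ c (x : submod_of M) : val (c *: x) = c * val x.
  exact: (linearZ_LR (val : submod_of M -> R^o)).
have gen_subquot (u : subquot M N) : exists a, val (repr u) - a * w \in N.
  exact: genM (valP _).
pose f (u : subquot M N) : quotmod P := \pi_(quotmod P) (xchoose (gen_subquot u)).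
(* Independence of the chosen a: two choices differ by an element of N : w. *)
have fE (x : submod_of M) a :
    val x - a * w \in N -> f (\pi_(subquot M N) x) = \pi_(quotmod P) a.
  move=> xaN; apply/eqP; rewrite pi_quotmod_eq -colonP mulrBl.
  have := xchooseP (gen_subquot (\pi x)); set b := xchoose _ => ybN.
  have : \pi_(subquot M N) (repr (\pi_(subquot M N) x)) == \pi x by rewrite reprK.
  rewrite pi_quotmod_eq inE raddfB => yxN.
  rewrite (_ : _ - _ = (val x - a * w) - (val (repr (\pi_(subquot M N) x)) - b * w)
    + (val (repr (\pi_(subquot M N) x)) - val x)); last by ring.
  by apply: ideal_add yxN; apply: ideal_sub.
have f_repr (u : subquot M N) a : val (repr u) - a * w \in N -> f u = \pi_(quotmod P) a.
  by move=> /fE; rewrite reprK.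
have f_lin : linear f.
  move=> c u v; have [a ua] := gen_subquot u; have [b vb] := gen_subquot v.
  rewrite (f_repr _ _ ua) (f_repr _ _ vb) -[u in LHS]reprK -[v in LHS]reprK.
  have -> : c *: \pi_(subquot M N) (repr u) + \pi_(subquot M N) (repr v) =
    \pi_(subquot M N) (c *: repr u + repr v).
    by rewrite pi_quotmodD pi_quotmodZ.
  rewrite (fE _ (c * a + b)) ?pi_quotmodD ?(pi_quotmodZ P) //.
  rewrite (_ : _ - _ = c * (val (repr u) - a * w) + (val (repr v) - b * w)).
    by apply: ideal_add vb; apply: ideal_mul.
  by rewrite valL; ring.
pose fL := GRing.isLinear.Build _ _ _ _ f f_lin.
pose F : {linear subquot M N -> quotmod P} := HB.pack f fL.
exists F; pose wM' : submod_of M := SubmodOf wM.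
exists (fun v => \pi_(subquot M N) (repr v *: wM')) => [u|v] /=.
  have [a ua] := gen_subquot u; rewrite (f_repr _ _ ua).
  rewrite -[u in RHS]reprK; apply/eqP; rewrite pi_quotmod_eq inE valB valZ.
  have: \pi_(quotmod P) (repr (\pi_(quotmod P) a)) == \pi a by rewrite reprK.
  rewrite pi_quotmod_eq -colonP mulrBl => aN.
  have := ideal_sub aN ua; congr (_ \in N).
  rewrite /=; ring.
by rewrite (fE _ (repr v)) ?reprK // valZ subrr rpred0.
Qed.

End CyclicSubquotient.

(** * From exponents to ideals of polynomials *)

Section MonomialIdealTheory.
Context (K : fieldType) (n : nat).
Local Notation S := {mpoly K[n]}.
Implicit Types (L : seq 'X_{1..n}) (A B : {set 'I_n}) (m u w : 'X_{1..n}) (p q : S).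

(** Testing the support makes membership boolean; [mono_ideal_monomial] shows that [L] generates
    this ideal. *)
Definition mono_ideal L : {pred S^o} := [pred p : S | all (upset L) (msupp p)].

Lemma mono_idealP L p :
  reflect (forall m, m \in msupp p -> upset L m) (p \in mono_ideal L).
Proof. exact: allP. Qed.

Fact mono_ideal_closed L : subsemimod_closed (mono_ideal L).
Proof.
split=> [|a p /mono_idealP pL]; last first.
  apply/mono_idealP => m /msuppM_le/allpairsP[[m1 m2] [_ /= /pL m2L ->]].
  by apply: upset_closed m2L _; exact: lem_addl.
split=> [|p q /mono_idealP pL /mono_idealP qL].
  by apply/mono_idealP; rewrite msupp0.
by apply/mono_idealP => m /msuppD_le; rewrite mem_cat => /orP[/pL|/qL].
Qed.

HB.instance Definition _ L := GRing.isSubSemiModClosed.Build S S^o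
  (mono_ideal L) (mono_ideal_closed L).

Lemma mono_idealX L m : ('X_[m] \in mono_ideal L) = upset L m.
Proof. by rewrite inE msuppX /= andbT. Qed.

Lemma mono_ideal_generated (T : choiceType) (F : T -> 'X_{1..n}) (B : {pred T}) L :
    (forall m, upset L m <-> exists2 t, t \in B & (F t <= m)%MM) ->
  generated_by (fun t => 'X_[F t] : S) B (mono_ideal L).
Proof.
move=> LB p; split=> [/mono_idealP pL|[s /allP sB ->]]; last first.
  rewrite big_seq; apply: (@rpred_sum S^o (mono_ideal L)) => c /sB cB.
  apply: (@ideal_mul S (mono_ideal L)); rewrite mono_idealX; apply/LB.
  by exists c.2 => //; exact: lepm_refl.
have {pL}: {subset msupp p <= upset L} by move=> m /pL.
(* Only the list of exponents varies in the induction; the coefficients remain those of [p]. *)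
rewrite [p in exists2 s, _ & p = _]mpolyE; elim: (msupp p) => [|m r IHr] rL.
  by exists [::]; rewrite // !big_nil.
have [m' m'r|s sB sE] := IHr; first by apply: rL; rewrite inE m'r orbT.
have /LB[t tB tm] : upset L m by apply: rL; exact: mem_head.
exists ((p@_m *: 'X_[m - F t], t) :: s); first by rewrite /= tB.
by rewrite !big_cons /= -sE -scalerAl -mpolyXD submK.
Qed.

Lemma mono_ideal_minus L w p : p \in mono_ideal (w :: L) ->
  exists a, p - a * 'X_[w] \in mono_ideal L.
Proof.
move=> /mono_idealP pL.
exists (\sum_(m <- msupp p | (w <= m)%MM) p@_m *: 'X_[m - w]).
rewrite {1}[p]mpolyE (bigID (fun m => (w <= m)%MM)) /= mulr_suml.
have -> : \sum_(m <- msupp p | (w <= m)%MM) p@_m *: 'X_[m - w] * 'X_[w] =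
    \sum_(m <- msupp p | (w <= m)%MM) p@_m *: 'X_[m].
  by apply: eq_bigr => m wm; rewrite -scalerAl -mpolyXD submK.
rewrite addrAC subrr add0r big_seq_cond; apply: (@rpred_sum S^o (mono_ideal L)).
move=> m /andP[/pL /=]; case: (w <= m)%MM => //= Lm _; rewrite -mul_mpolyC.
by apply: (@ideal_mul S (mono_ideal L)); rewrite mono_idealX.
Qed.

Lemma mono_ideal_colon L A w :
    (forall m, upset L (w + m)%MM = upset (variables A) m) ->
  forall a, (a * 'X_[w] \in mono_ideal L) = (a \in mono_ideal (variables A)).
Proof.
move=> colonA a; rewrite !inE (perm_all _ (msuppMX _ _)) all_map.
by apply: eq_all => m /=; rewrite colonA.
Qed.

(** The substitution x_i = 0 for i in [A]. Its kernel is (x_i | i in A), which is therefore prime, S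
    being a domain. *)
Definition kill A := mmap (@mpolyC n K) (fun i => if i \in A then 0 else 'X_i : S).

Lemma kill_coef A p m : (kill A p)@_m = if upset (variables A) m then 0 else p@_m.
Proof.
have killX u : mmap1 (fun i => if i \in A then 0 else 'X_i : S) u =
    if upset (variables A) u then 0 else 'X_[u].
  case: (upset_variablesP A u) => [[i iA]|uA].
    by rewrite lep1mP /mmap1 (bigD1 i) //= iA expr0n => /negbTE->; rewrite mul0r.
  rewrite -[RHS]mmap1_id; apply: eq_bigr => i _; case: ifP => // iA.
  have [->|ui] := eqVneq (u i) 0; first by rewrite !expr0.
  by case: uA; exists i => //; rewrite lep1mP.
rewrite /kill /mmap raddf_sum /=.
under eq_bigr => u _ do rewrite killX mcoeffCM.
rewrite [p in RHS]mpolyE raddf_sum /=.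
have [mA|mA] := boolP (upset _ m).
  apply: big1 => u _; case: ifP => uA; first by rewrite mcoeff0 mulr0.
  by rewrite mcoeffX; case: eqP uA => [->|]; rewrite ?mA // mulr0.
apply: eq_bigr => u _; rewrite mcoeffZ; case: ifP => // uA.
by rewrite mcoeffX; case: eqP uA mA => [-> ->|] // _ _ _; rewrite mcoeff0.
Qed.

Lemma mono_ideal_kill A p : (p \in mono_ideal (variables A)) = (kill A p == 0).
Proof.
apply/mono_idealP/eqP => [pA|/mpolyP p0 m].
  apply/mpolyP => m; rewrite kill_coef mcoeff0; case: ifP => // mA.
  by apply/eqP; rewrite mcoeff_eq0; apply: contraFN mA => /pA.
rewrite mcoeff_msupp => pm; apply: contraNT pm => mA; have := p0 m.
by rewrite kill_coef (negbTE mA) mcoeff0 => ->.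
Qed.

Lemma mono_ideal_prime A : prime_ideal (mono_ideal (variables A) : {pred S}).
Proof.
have killM : {morph kill A : p q / p * q}.
  exact: (rmorphM (mmap (@mpolyC n K) (fun i => if i \in A then 0 else 'X_i : S))).
have kill1 : kill A 1 = 1.
  exact: (rmorph1 (mmap (@mpolyC n K) (fun i => if i \in A then 0 else 'X_i : S))).
split.
  split; first exact: (@rpred0 S^o (mono_ideal (variables A))).
    by rewrite mono_ideal_kill kill1 oner_eq0.
  by move=> a p q pA qA; apply: ideal_add qA; exact: ideal_mul.
by move=> p q; rewrite !mono_ideal_kill killM mulf_eq0.
Qed.

Lemma mono_ideal_variables_prime A :
  monomial_prime (mono_ideal (variables A) : {pred S}).
Proof.
split; first exact: mono_ideal_prime; exists A.
by apply: mono_ideal_generated => m; split=> /upset_variablesP.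
Qed.

Lemma mono_ideal_monomial L : monomial_generators (mem L) (mono_ideal L : {pred S}).
Proof. by apply: mono_ideal_generated => m; split=> /hasP. Qed.

Lemma generated_by_ext (R : comNzRingType) T (F : T -> R) (D : {pred T})
    (I J : {pred R}) :
  generated_by F D I -> generated_by F D J -> I =i J.
Proof. by move=> genI genJ x; apply/idP/idP => [/genI/genJ|/genJ/genI]. Qed.

Lemma mono_ideal_sub A B :
  {subset (mono_ideal (variables A) : {pred S}) <= mono_ideal (variables B)} ->
  A \subset B.
Proof.
move=> sAB; apply/subsetP => i; rewrite -!upset_variables1 -!mono_idealX.
exact: sAB.
Qed.

Lemma strict_sub_variables A B : A \proper B ->
  strict_sub (mono_ideal (variables A) : {pred S}) (mono_ideal (variables B)).
Proof.
case/properP => /subsetP sAB [i iB iA]; split=> [p /mono_idealP pA|].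
  apply/mono_idealP => m /pA/upset_variablesP[j /sAB jB jm].
  by apply/upset_variablesP; exists j.
by exists 'X_i; rewrite mono_idealX upset_variables1.
Qed.

(** Each step puts its monomial in front of the list, hence [catrev]. *)
Lemma prime_filtration_nth L s x0 i : prime_filtration L s -> (i < size s)%N ->
  forall m, upset (catrev [seq c.1 | c <- take i s] L) ((nth x0 s i).1 + m)%MM =
    upset (variables (nth x0 s i).2) m.
Proof.
elim: s L i => // -[w A] s IHs L [|i] /= [colonA fs] // lt_is.
exact: IHs.
Qed.

Lemma prime_filtration_last L s : prime_filtration L s ->
  upset (catrev [seq c.1 | c <- s] L) 0%MM.
Proof. by elim: s L => // -[w A] s IHs L /= [_ /IHs]. Qed.

Lemma pretty_clean_of_filtration (I : ideal S) L s :
    I =i mono_ideal L -> prime_filtration L s ->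
    sorted geq [seq #|c.2| | c : 'X_{1..n} * {set 'I_n} <- s] ->
  pretty_clean I.
Proof.
move=> IL fs sort_s; pose x0 : 'X_{1..n} * {set 'I_n} := (0%MM, set0).
pose J i := catrev [seq c.1 | c <- take i s] L; pose A i := (nth x0 s i).2.
have JS i : (i < size s)%N -> J i.+1 = (nth x0 s i).1 :: J i.
  by move=> lt_is; rewrite /J (take_nth x0) // map_rcons !catrevE rev_rcons.
exists (size s), (fun i => mono_ideal (J i) : ideal S),
  (fun i => mono_ideal (variables (A i)) : ideal S).
split.
- rewrite /J take0 take_size; split=> p; first by rewrite IL.
  apply/mono_idealP => m _; apply: upset_closed (prime_filtration_last fs) _.
  by apply/mnm_lepP => i; rewrite mnm0E.
- by move=> i _; exists (fun m => m \in J i); exact: mono_ideal_monomial.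
- move=> i lt_is; rewrite JS //; split=> [p /mono_idealP pJ|].
    by apply/mono_idealP => m /pJ Jm; rewrite /= -/(upset _ _) Jm orbT.
  exists 'X_[(nth x0 s i).1]; rewrite mono_idealX /=; first by rewrite lepm_refl.
  by rewrite -[(nth x0 s i).1]addm0 (prime_filtration_nth x0 fs) // upset_variables0.
- move=> i lt_is; split; first exact: mono_ideal_variables_prime.
  rewrite JS //; apply: (@cyclic_subquot_iso _ _ _ _ 'X_[(nth x0 s i).1]).
  + by rewrite mono_idealX /= lepm_refl.
  + by apply: mono_ideal_colon; exact: prime_filtration_nth fs lt_is.
  + by move=> p; exact: mono_ideal_minus.
move=> i j /andP[lt_ij lt_js] /mono_ideal_sub sAB.
suff -> : A i = A j by [].
apply/eqP; rewrite eqEcard sAB /=.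
have tr : transitive geq by move=> a b c /= ba cb; exact: leq_trans cb ba.
have := sorted_ltn_nth tr 0%N sort_s; move/(_ i j); rewrite !inE size_map.
rewrite (ltn_trans lt_ij) // lt_js => /(_ isT isT lt_ij).
by rewrite !(nth_map x0) // (ltn_trans lt_ij).
Qed.

End MonomialIdealTheory.

(** * Independence of elements along a chain of primes *)

Section PrimeChains.
Context (R : comNzRingType).
Implicit Types (C : nat -> {pred R}) (x : nat -> R).

Lemma prime_idealD (P : {pred R}) (u v : R) :
  prime_ideal P -> u \in P -> v \in P -> u + v \in P.
Proof. by move=> [[_ _ PD] _] uP vP; rewrite -[u]mul1r PD. Qed.

Lemma prime_idealM (P : {pred R}) (a u : R) : prime_ideal P -> u \in P -> a * u \in P.
Proof. by move=> [[P0 _ PD] _] uP; rewrite -[_ * _]addr0 PD. Qed.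

Lemma prime_idealX (P : {pred R}) (u : R) k :
  prime_ideal P -> u \notin P -> u ^+ k \notin P.
Proof.
move=> [[_ P1 _] PM] uP; elim: k => [|k IHk]; first by rewrite expr0.
by rewrite exprS; apply: contra IHk => /PM; rewrite (negbTE uP).
Qed.

(* With m the lexicographically least exponent of a relation, x_0^m_0 divides *)
(* the relation; as x_0 lies in C 1 but not in C 0, dividing it out and       *)
(* reducing modulo C 1 leaves a shorter relation, in x_1, ..., x_(N-1).       *)
Lemma prime_chain_independent (J : finType) N C x (f : J -> nat -> nat) (c : J -> R)
    (B : {set J}) :
    (forall i, (i <= N)%N -> prime_ideal (C i)) ->
    (forall i, (i < N)%N -> {subset C i <= C i.+1}) ->
    (forall i, (i < N)%N -> x i \in C i.+1 /\ x i \notin C i) ->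
    {in B &, forall j k, (forall i, (i < N)%N -> f j i = f k i) -> j = k} ->
    (forall j, j \in B -> exists d, d * c j = 1) -> B != set0 ->
  \sum_(j in B) c j * \prod_(i < N) x i ^+ f j i \notin C 0.
Proof.
move=> + + + + + /set0Pn[j0 j0B].
elim: N C x f B j0 j0B => [|N IHN] C x f B j0 j0B primeC subC xC injf unitc.
  (* Without variables all exponents agree, so [B] is a singleton and the sum is a unit. *)
  have BE j : (j \in B) = (j == j0).
    by apply/idP/eqP => [jB|->//]; apply: injf.
  rewrite (big_pred1 j0) // big_ord0 mulr1; apply/negP => cC.
  have [d dc] := unitc _ j0B; have primeC0 := primeC _ (leqnn _).
  by have [[_ /negP C1 _] _] := primeC0; apply: C1; rewrite -dc prime_idealM.
have [j jB jmin] := arg_minnP (fun j => f j 0) j0B; change (is_true (j \in B)) in jB.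
have [xC1 xC0] := xC _ (ltn0Sn N).
have primeC0 := primeC _ (leq0n _); have primeC1 := primeC _ (ltn0Sn N).
pose g k := \prod_(i < N) x i.+1 ^+ f k i.+1.
have -> : \sum_(k in B) c k * \prod_(i < N.+1) x i ^+ f k i =
    x 0 ^+ f j 0 * \sum_(k in B) c k * (x 0 ^+ (f k 0 - f j 0) * g k).
  rewrite mulr_sumr; apply: eq_bigr => k kB; rewrite big_ord_recl /=.
  by rewrite -[in LHS](subnK (jmin k kB)) exprD /g; ring.
apply/negP => /(proj2 primeC0) /orP[]; first exact/negP/prime_idealX.
move=> /(subC _ (ltn0Sn N)); rewrite (bigID (fun k => f k 0 == f j 0)) /=.
set T1 := \sum_(k in B | _) _; set T2 := (\sum_(k in B | _) _).
have T2C : T2 \in C 1.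
  have [[C10 _ _] _] := primeC1.
  apply: (big_ind (fun t => t \in C 1)) => // [u v|k /andP[kB kj]].
    exact: prime_idealD.
  rewrite mulrCA mulrC; apply: prime_idealM => //.
  rewrite -(@prednK (f k 0 - f j 0)); first by rewrite exprSr prime_idealM.
  by rewrite subn_gt0 ltn_neqAle eq_sym kj jmin.
move=> TC; have {TC T2C} : T1 \in C 1.
  by rewrite -(addrK T2 T1) -mulN1r prime_idealD // prime_idealM.
apply/negP; pose B' := [set k in B | f k 0 == f j 0].
have -> : T1 = \sum_(k in B') c k * \prod_(i < N) x i.+1 ^+ f k i.+1.
  apply: eq_big => [k|k /andP[_ /eqP ->]]; first by rewrite inE.
  by rewrite subnn expr0 mul1r.
apply: (IHN (C \o succn) (x \o succn) (fun k => f k \o succn) B' j) => //=.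
- by rewrite inE jB eqxx.
- by move=> i iN; exact: primeC.
- by move=> i iN; exact: subC.
- by move=> i iN; exact: xC.
- move=> k l; rewrite !inE => /andP[kB /eqP kj] /andP[lB /eqP lj] fkl.
  by apply: injf => // -[_|i iN]; [rewrite kj lj | exact: fkl].
- by move=> k; rewrite inE => /andP[kB _]; exact: unitc.
Qed.

End PrimeChains.

(** * The bound n on chains of primes, and heights of monomial primes *)

Section Dimension.
Context (K : fieldType) (n : nat).
Local Notation S := {mpoly K[n]}.

Definition degree_le d (p : S) := {in msupp p, forall m, (mdeg m <= d)%N}.

Lemma degree_leM d e p q : degree_le d p -> degree_le e q -> degree_le (d + e) (p * q).
Proof.
move=> dp eq m /msuppM_le/allpairsP[[m1 m2] [/= /dp m1d /eq m2e ->]].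
by rewrite mdegD leq_add.
Qed.

Lemma degree_le1 : degree_le 0 1.
Proof. by move=> m; rewrite msupp1 inE => /eqP->; rewrite mdeg0. Qed.

Lemma degree_leX d p k : degree_le d p -> degree_le (k * d) (p ^+ k).
Proof.
move=> dp; elim: k => [|k IHk]; first by rewrite expr0; exact: degree_le1.
by rewrite exprS mulSn; exact: degree_leM.
Qed.

(* The (d + 1)^(n + 1) products with exponents at most d lie in the span of   *)
(* (b + 1)^n monomials, where b is linear in d.                               *)
Lemma algebraic_dependence (x : nat -> S) :
  exists d (c : {ffun 'I_n.+1 -> 'I_d.+1} -> K), (exists j, c j != 0) /\
    \sum_j c j *: \prod_(i < n.+1) x i ^+ j i = 0.
Proof.
(* With d = e^n one gets (b + 1)^n <= (e (d + 1))^n = d (d + 1)^n < (d + 1)^(n + 1). *)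
pose D := (\max_(i < n.+1) msize (x i))%N; pose e := (n.+1 * D).+1; pose d := (e ^ n)%N.
pose b := (n.+1 * (d * D))%N; pose J := {ffun 'I_n.+1 -> 'I_d.+1}.
pose y (j : J) := \prod_(i < n.+1) x i ^+ j i.
have yb j : degree_le b (y j).
  have -> : b = (\sum_(i < n.+1) d * D)%N by rewrite sum_nat_const card_ord.
  apply: (big_ind2 (fun p k => degree_le k p)) => [||i _]; first exact: degree_le1.
    by move=> p k q l; exact: degree_leM.
  have xD : degree_le D (x i).
    move=> m /msize_mdeg_lt/ltnW mD; apply: leq_trans mD _.
    exact: (leq_bigmax (F := fun i : 'I_n.+1 => msize (x i))).
  move=> m /(degree_leX xD) mjD; apply: leq_trans mjD _.
  by rewrite leq_mul2r -ltnS ltn_ord orbT.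
pose G := {ffun 'I_n -> 'I_b.+1}; pose mon (g : G) := [multinom (g i : nat) | i < n].
have card_lt : (#|G| < #|J|)%N.
  rewrite !card_ffun !card_ord; apply: (@leq_ltn_trans ((e * d.+1) ^ n)).
    case: (n) => // n'; rewrite leq_exp2r //.
    by rewrite /b /e mulSn mulnS [(d * D)%N]mulnC !mulnA; lia.
  by rewrite expnMn expnSr mulnC ltn_mul2l expn_gt0 /= ltnS.
(* More rows than columns: a nonzero vector of the left kernel is the desired relation. *)
pose M := \matrix_(i < #|J|, k < #|G|) (y (enum_val i))@_(mon (enum_val k)).
have /rowV0Pn[v /sub_kermxP vM v0] : kermx M != 0.
  by rewrite -mxrank_eq0 mxrank_ker -lt0n subn_gt0 (leq_ltn_trans (rank_leq_col M)).
exists d, (fun j => v 0 (enum_rank j)); split.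
  by have /rV0Pn[i vi] := v0; exists (enum_val i); rewrite enum_valK.
apply/mpolyP => m; rewrite mcoeff0 raddf_sum /=.
have [/forallP mb|/forallPn[i]] := boolP [forall i, m i < b.+1]%N.
  pose g : G := [ffun i => Ordinal (mb i)].
  have -> : m = mon g by apply/mnmP => i; rewrite mnmE ffunE.
  have /matrixP/(_ 0 (enum_rank g)) := vM; rewrite !mxE => vM0; rewrite -[RHS]vM0.
  rewrite (reindex_omap enum_val (fun j => Some (enum_rank j))) /=; last first.
    by move=> j _; rewrite enum_rankK.
  apply: eq_big => [k|k _]; first by rewrite enum_valK eqxx.
  by rewrite mcoeffZ enum_valK mxE enum_rankK.
(* An exponent above b exceeds the degree of every product. *)
rewrite -leqNgt => mi; apply: big1 => j _; rewrite mcoeffZ.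
have [/yb|] := boolP (m \in msupp (y j)); last first.
  by rewrite -mcoeff_eq0 => /eqP->; rewrite mulr0.
by rewrite mdegE (bigD1 i) //= leqNgt (leq_trans mi) ?leq_addr.
Qed.

(** A longer chain would give n + 1 elements satisfying a relation by [algebraic_dependence]; its
    value 0 lies in C 0, against [prime_chain_independent]. *)
Lemma prime_chain_length (C : nat -> {pred S}) N :
    (forall i, (i <= N)%N -> prime_ideal (C i)) ->
    (forall i, (i < N)%N -> strict_sub (C i) (C i.+1)) ->
  (N <= n)%N.
Proof.
move=> primeC strictC; rewrite leqNgt; apply/negP => ltnN.
have /fin_all_exists[u uC] (i : 'I_n.+1) : exists u, u \in C i.+1 /\ u \notin C i.
  by have [_ [u]] := strictC i (leq_trans (ltn_ord i) ltnN); exists u.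
pose x i := u (inord i); have [d [c [[j0 cj0] rel0]]] := algebraic_dependence x.
have := @prime_chain_independent S _ n.+1 C x
  (fun (j : {ffun 'I_n.+1 -> 'I_d.+1}) i => j (inord i))
  (fun j => (c j)%:MP) [set j | c j != 0].
have -> : \sum_(j in [set j | c j != 0]) (c j)%:MP *
    \prod_(i < n.+1) x i ^+ (j (inord i)) = 0.
  rewrite -[RHS]rel0 [RHS](bigID (fun j => c j == 0)) /= [X in _ = X + _]big1 ?add0r.
    apply: eq_big => j; rewrite ?inE // => _; rewrite mul_mpolyC.
    by congr (_ *: _); apply: eq_bigr => i _; rewrite inord_val.
  by move=> j /eqP->; rewrite scale0r.
have [[C0 _ _] _] := primeC 0 isT; rewrite C0 => H; suff: false by []; apply: H => //.
- by move=> i iN; apply: primeC; exact: leq_trans iN ltnN.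
- by move=> i iN; have [] := strictC i (leq_trans iN ltnN).
- move=> i iN; have := uC (Ordinal iN).
  by rewrite /x -[i in u (inord i)]/(val (Ordinal iN)) inord_val.
- move=> j k _ _ jk; apply/ffunP => i; apply: val_inj.
  by have := jk i (ltn_ord i); rewrite inord_val.
- move=> j; rewrite inE => cj; exists ((c j)^-1)%:MP.
  by rewrite -mpolyCM mulVf.
- by apply/set0Pn; exists j0; rewrite inE.
Qed.

(** Adjoining the n - #|A| other variables one by one prolongs a chain of length h ending at (x_i |
    i in A), so h + n - #|A| <= n. *)
Lemma prime_height_variables (A : {set 'I_n}) h :
  prime_height_ge (mono_ideal (variables A) : {pred S}) h -> (h <= #|A|)%N.
Proof.
case=> C [primeC strictC CA]; pose e := enum (~: A).
pose B k := A :|: [set i in take k e].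
pose C' i : {pred S} := if (i < h)%N then C i else mono_ideal (variables (B (i - h)%N)).
suff : (h + size e <= n)%N.
  by move=> le_n; rewrite -(leq_add2r #|~: A|) cardsC card_ord cardE.
apply: (@prime_chain_length C') => i; rewrite /C' => le_i.
  by case: ltnP => [/ltnW/primeC//|_]; exact: mono_ideal_prime.
case: (ltngtP i.+1 h) => [lt_ih|lt_hi|eq_ih].
- by apply: strictC; exact: ltnW.
- rewrite subSn //; set k := (i - h)%N.
  have lt_k : (k < size e)%N by rewrite ltn_subLR.
  have x0 := tnth (in_tuple e) (Ordinal lt_k); pose j := nth x0 e k.
  have jA : j \notin A by rewrite -in_setC -mem_enum mem_nth.
  have := take_uniq k.+1 (enum_uniq (~: A)).
  rewrite -/e (take_nth x0) // rcons_uniq => /andP[jk _].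
  apply: strict_sub_variables; rewrite /B (take_nth x0) // -/j.
  apply/properP; split; last first.
    by exists j; rewrite !inE ?mem_rcons ?mem_head ?orbT // negb_or jA.
  by apply/setUS/subsetP => i'; rewrite !inE mem_rcons inE => ->; rewrite orbT.
(* The junction: [C h] and the monomial prime have the same elements. *)
- have lt_ih : (i < h)%N by rewrite -eq_ih.
  rewrite eq_ih subnn /B take0.
  have -> : A :|: [set i in [::]] = A by apply/setP => j; rewrite !inE orbF.
  have [sC [u uC uNC]] := strictC i lt_ih; rewrite eq_ih in sC uC.
  by split=> [p /sC|]; [rewrite CA | exists u => //; rewrite -CA].
Qed.

End Dimension.

(** * Conclusion *)

Theorem theorem2p5 (K : fieldType) (n : nat) (I : ideal {mpoly K[n]}) :
  monomial_ideal I -> almost_complete_intersection I -> pretty_clean I.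
Proof.
move=> _ [G [h [[genI _] [_ heightI] sizeG]]].
have IG : I =i mono_ideal (enum_fset G).
  by apply: generated_by_ext genI _; exact: mono_ideal_monomial.
(* A transversal gives a monomial prime containing [I], to which the height bound applies. *)
have tauG : transversal_ge h (enum_fset G).
  move=> A /allP tA; apply: (@prime_height_variables K n).
  apply: heightI (mono_ideal_prime _ _) _ => p; rewrite IG => /mono_idealP pG.
  apply/mono_idealP => m /pG/hasP[u /tA uA um]; exact: upset_closed uA um.
have [|s fs /andP[_ sort_s]] := sorted_prime_filtration _ tauG; first by rewrite sizeG.
exact: pretty_clean_of_filtration IG fs sort_s.
Qed.
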